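(* Let $\phi_1: M_3(\mathbb{C})\to M_3(\mathbb{C})$ be a PPT map, let $\phi_2: M_3(\mathbb{C})\to M_3(\mathbb{C})$ be a completely positive map, and let $\rho\in M_n\otimes M_3$ be a bipartite state. If $(I_n\otimes\phi_2)(\rho)$ has Schmidt number at most two, then the state $(I_n\otimes(\phi_1\circ\phi_2))(\rho)$ is separable.
   Context: A linear map $\phi$ on $M_3(\mathbb{C})$ is a PPT map if it is both completely positive and completely copositive (both $\phi$ and $T\circ\phi$ are completely positive, $T$ the transpose). $I_n$ is the identity map on $M_n$. A positive semidefinite $\sigma\in M_n\otimes M_3$ has Schmidt number at most $k$ if it can be written as $\sigma=\sum_j p_j|a_j\rangle\langle a_j|$ with $p_j\ge0$ and each vector $|a_j\rangle\in\mathbb{C}^n\otimes\mathbb{C}^3$ of Schmidt rank at most $k$. A positive semidefinite matrix is separable if it is a nonnegative combination of products $\alpha\otimes\beta$ with $\alpha,\beta$ positive semidefinite. *)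

(* Defs.v *)
(* Complex numbers are modelled as R[i] for R : realType
   (MathComp-Analysis reals, unique up to isomorphism = the real numbers). *)
From HB Require Import structures.
From mathcomp Require Import all_boot all_order all_algebra.
From mathcomp Require Export reals complex.
Set Implicit Arguments. Unset Strict Implicit. Unset Printing Implicit Defensive.
Import Order.TTheory GRing.Theory Num.Theory.
Local Open Scope ring_scope.

Section QuantumDefs.
Variable C : numClosedFieldType.

Definition adjmx {m n} (A : 'M[C]_(m, n)) : 'M[C]_(n, m) := (map_mx Num.conj A)^T.

Definition psdmx {n} (A : 'M[C]_n) : Prop :=
  adjmx A = A /\ forall v : 'cV[C]_n, 0 <= (adjmx v *m A *m v) 0 0.

(* C^m (x) C^n is indexed by 'I_(m*n), with the pair (i,j) encoded as
   mxvec_index i j; tidx is the inverse decoding. *)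
Definition tidx {m n} (p : 'I_(m * n)) : 'I_m * 'I_n :=
  enum_val (cast_ord (esym (mxvec_cast m n)) p).

Definition kron {m n p q} (A : 'M[C]_(m, n)) (B : 'M[C]_(p, q)) : 'M[C]_(m * p, n * q) :=
  \matrix_(i, j) (A (tidx i).1 (tidx j).1 * B (tidx i).2 (tidx j).2).

(* (I_k (x) phi)(X): apply phi to each d x d block of X in M_k (x) M_d *)
Definition ampl {d} (k : nat) (phi : 'M[C]_d -> 'M[C]_d) (X : 'M[C]_(k * d)) : 'M[C]_(k * d) :=
  \matrix_(p, q)
    phi (\matrix_(a, b) X (mxvec_index (tidx p).1 a) (mxvec_index (tidx q).1 b))
        (tidx p).2 (tidx q).2.

Definition completely_positive {d} (phi : 'M[C]_d -> 'M[C]_d) : Prop :=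
  forall (k : nat) (X : 'M[C]_(k * d)), psdmx X -> psdmx (@ampl d k phi X).

Definition PPT_map {d} (phi : 'M[C]_d -> 'M[C]_d) : Prop :=
  completely_positive phi /\ completely_positive (fun X => (phi X)^T).

Definition schmidt_rank {m n} (v : 'cV[C]_(m * n)) : nat :=
  \rank (\matrix_(i, a) v (mxvec_index i a) 0).

Definition schmidt_number_le {m n} (k : nat) (s : 'M[C]_(m * n)) : Prop :=
  psdmx s /\
  exists (N : nat) (p : 'I_N -> C) (a : 'I_N -> 'cV[C]_(m * n)),
    (forall j, 0 <= p j) /\ (forall j, (schmidt_rank (a j) <= k)%N) /\
    s = \sum_(j < N) p j *: (a j *m adjmx (a j)).

Definition separable {m n} (s : 'M[C]_(m * n)) : Prop :=
  psdmx s /\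
  exists (N : nat) (p : 'I_N -> C) (al : 'I_N -> 'M[C]_m) (be : 'I_N -> 'M[C]_n),
    (forall j, 0 <= p j /\ psdmx (al j) /\ psdmx (be j)) /\
    s = \sum_(j < N) p j *: kron (al j) (be j).

Definition is_state {N} (r : 'M[C]_N) : Prop := psdmx r /\ \tr r = 1.

End QuantumDefs.
Arguments ampl {C d} k phi X.

(* Main.v *)
(* A vector of Schmidt rank two is u (x) w + v (x) x, so phi1 sends its projector
   to sum_(k, l) u_k u_l^h (x) X_kl, where X is a 2x2 block matrix of 3x3 blocks.
   Complete positivity and copositivity of phi1 say that X and its partial
   transpose are positive, so it suffices that positive partial transpose implies
   separability for 2x2 block matrices of NxN blocks, N <= 3.  This is proved by
   induction on N, then on rank X + rank (pt X).  If the upper left block is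
   singular, a Schur complement leads to a smaller N; otherwise it is normalised
   to 1, X = (1, B; B^h, D), and there are two cases.
   - If D - B^h B = p p^h and D - B B^h = q q^h, the vectors q, B^h q, p, B p of
     C^N are dependent, which makes (B, q; p^h, c) normal for some c and a
     suitable phase of q; its spectral decomposition decomposes X.
   - Otherwise the ranks are so large that a dimension count gives a direction H
     along which X can be moved both ways until a rank drops. *)
Require Import Defs.
From HB Require Import structures.
From mathcomp Require Import all_boot all_order all_algebra.
From mathcomp Require Import reals complex.
From mathcomp Require Import zify ring.
Import Order.TTheory GRing.Theory Num.Theory.
Local Open Scope ring_scope.
Set Implicit Arguments. Unset Strict Implicit. Unset Printing Implicit Defensive.

Local Notation "A ^h" := (adjmx A) (at level 2, left associativity, format "A ^h").

(** * Adjoints, positive semidefinite matrices and their ranks *)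

Section Positive.
Variable C : numClosedFieldType.

Lemma adjmxE m n (A : 'M[C]_(m, n)) i j : A^h i j = (A j i)^*.
Proof. by rewrite !mxE. Qed.

Lemma adjmxK m n (A : 'M[C]_(m, n)) : A^h^h = A.
Proof. by apply/matrixP=> i j; rewrite !mxE conjCK. Qed.

Lemma adjmx0 m n : (0 : 'M[C]_(m, n))^h = 0.
Proof. by apply/matrixP=> i j; rewrite !mxE conjC0. Qed.

Lemma adjmx1 n : (1%:M : 'M[C]_n)^h = 1%:M.
Proof. by rewrite /adjmx map_mx1 trmx1. Qed.

Lemma adjmxD m n (A B : 'M[C]_(m, n)) : (A + B)^h = A^h + B^h.
Proof. by rewrite /adjmx map_mxD linearD. Qed.

Lemma adjmxN m n (A : 'M[C]_(m, n)) : (- A)^h = - A^h.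
Proof. by rewrite /adjmx map_mxN linearN. Qed.

Lemma adjmxB m n (A B : 'M[C]_(m, n)) : (A - B)^h = A^h - B^h.
Proof. by rewrite adjmxD adjmxN. Qed.

Lemma adjmxZ m n a (A : 'M[C]_(m, n)) : (a *: A)^h = a^* *: A^h.
Proof. by rewrite /adjmx map_mxZ linearZ. Qed.

Lemma adjmxM m n p (A : 'M[C]_(m, n)) (B : 'M_(n, p)) : (A *m B)^h = B^h *m A^h.
Proof. by rewrite /adjmx map_mxM trmx_mul. Qed.

Lemma adjmx_col m1 m2 n (A : 'M[C]_(m1, n)) (B : 'M_(m2, n)) :
  (col_mx A B)^h = row_mx A^h B^h.
Proof. by rewrite /adjmx map_col_mx tr_col_mx. Qed.

Lemma adjmx_row m n1 n2 (A : 'M[C]_(m, n1)) (B : 'M_(m, n2)) :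
  (row_mx A B)^h = col_mx A^h B^h.
Proof. by rewrite /adjmx map_row_mx tr_row_mx. Qed.

Lemma adjmx_block m1 m2 n1 n2 (A : 'M[C]_(m1, n1)) (B : 'M_(m1, n2))
    (D : 'M_(m2, n1)) (E : 'M_(m2, n2)) :
  (block_mx A B D E)^h = block_mx A^h D^h B^h E^h.
Proof. by rewrite /adjmx map_block_mx tr_block_mx. Qed.

Lemma mxtrace_adj n (A : 'M[C]_n) : \tr A^h = (\tr A)^*.
Proof. by rewrite /adjmx mxtrace_tr /mxtrace rmorph_sum; apply: eq_bigr => i _; rewrite mxE. Qed.

Lemma adjmx_inj m n : injective (@adjmx C m n).
Proof. exact: (can_inj (@adjmxK m n)). Qed.

Lemma gram00 n (v : 'cV[C]_n) : (v^h *m v) 0 0 = \sum_i `|v i 0| ^+ 2.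
Proof. by rewrite mxE; apply: eq_bigr => i _; rewrite !mxE mulrC normCK. Qed.

Lemma gram_ge0 n (v : 'cV[C]_n) : 0 <= (v^h *m v) 0 0.
Proof. by rewrite gram00 sumr_ge0 // => i _; rewrite exprn_ge0. Qed.

Lemma gram_eq0 n (v : 'cV[C]_n) : ((v^h *m v) 0 0 == 0) = (v == 0).
Proof.
apply/idP/eqP => [|->]; last by rewrite mulmx0 mxE.
rewrite gram00 psumr_eq0 => [/allP v0|i _]; last by rewrite exprn_ge0.
apply/matrixP=> i j; rewrite ord1 !mxE; apply/eqP.
by have := v0 i (mem_index_enum i); rewrite expf_eq0 normr_eq0.
Qed.

Lemma gram_mx_eq0 m n (A : 'M[C]_(m, n)) : A^h *m A = 0 -> A = 0.
Proof.
move=> AA0; apply/matrixP => i j.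
have /eqP/matrixP/(_ i 0) : col j A == 0.
  by rewrite -gram_eq0 colE adjmxM -mulmxA (mulmxA _ A) AA0 mul0mx mulmx0 mxE.
by rewrite !mxE.
Qed.

Lemma psd_herm n (X : 'M[C]_n) : psdmx X -> X^h = X.
Proof. by case. Qed.

Lemma psd_gram m n (S : 'M[C]_(m, n)) : psdmx (S *m S^h).
Proof.
split=> [|v]; first by rewrite adjmxM adjmxK.
by rewrite mulmxA -mulmxA -{1}(adjmxK S) -adjmxM gram_ge0.
Qed.

Lemma psd_congr m n (T : 'M[C]_(m, n)) (X : 'M_m) : psdmx X -> psdmx (T^h *m X *m T).
Proof.
case=> hX pX; split=> [|v]; first by rewrite !adjmxM adjmxK hX mulmxA.
by have := pX (T *m v); rewrite adjmxM !mulmxA.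
Qed.

Lemma psd0 n : psdmx (0 : 'M[C]_n).
Proof. by split=> [|v]; rewrite ?adjmx0 // mulmx0 mul0mx mxE. Qed.

Lemma psdD n (X Y : 'M[C]_n) : psdmx X -> psdmx Y -> psdmx (X + Y).
Proof.
move=> [hX pX] [hY pY]; split=> [|v]; first by rewrite adjmxD hX hY.
by rewrite mulmxDr mulmxDl mxE addr_ge0.
Qed.

Lemma psdZ n a (X : 'M[C]_n) : 0 <= a -> psdmx X -> psdmx (a *: X).
Proof.
move=> a0 [hX pX]; split=> [|v]; first by rewrite adjmxZ hX (CrealP (ger0_real a0)).
by rewrite -scalemxAr -scalemxAl mxE mulr_ge0.
Qed.

Lemma normal_spectral n (A : 'M[C]_n) : A *m A^h = A^h *m A ->
  exists P (d : 'rV_n), [/\ P *m P^h = 1%:M, P^h *m P = 1%:M & A = P^h *m diag_mx d *m P].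
Proof.
rewrite /adjmx map_trmx => /normalmxP/orthomx_spectralP AE.
have U := spectral_unitarymx A.
have Uh : (spectralmx A)^h = invmx (spectralmx A).
  by rewrite (invmx_unitary U) /adjmx map_trmx.
exists (spectralmx A), (spectral_diag A); rewrite -/(adjmx _) Uh.
by split; rewrite // ?mulmxV ?mulVmx ?spectral_unit.
Qed.

Lemma spectral_diagE n (P X : 'M[C]_n) (d : 'rV_n) : P *m P^h = 1%:M ->
  X = P^h *m diag_mx d *m P -> P *m X *m P^h = diag_mx d.
Proof. by move=> PP ->; rewrite !mulmxA PP mul1mx -mulmxA PP mulmx1. Qed.

Lemma herm_spectral n (X : 'M[C]_n) : X^h = X ->
  exists P (d : 'rV_n), [/\ P *m P^h = 1%:M, P^h *m P = 1%:M,
     X = P^h *m diag_mx d *m P & forall i, d 0 i \is Num.real].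
Proof.
move=> hX; have [P [d [PP PP' XE]]] : exists P (d : 'rV_n),
  [/\ P *m P^h = 1%:M, P^h *m P = 1%:M & X = P^h *m diag_mx d *m P].
  by apply: normal_spectral; rewrite hX.
exists P, d; split=> // i; apply/CrealP.
have dE := spectral_diagE PP XE.
have : (diag_mx d)^h = diag_mx d by rewrite -dE !adjmxM adjmxK hX mulmxA.
by move/matrixP/(_ i i); rewrite !mxE eqxx.
Qed.

Lemma psd_diag_ge0 n (X : 'M[C]_n) i : psdmx X -> 0 <= X i i.
Proof.
case=> _ /(_ (delta_mx i 0)).
suff -> : ((delta_mx i 0)^h *m X *m delta_mx i 0 : 'M_1) 0 0 = X i i by [].
by rewrite /adjmx map_delta_mx trmx_delta -rowE -colE !mxE.
Qed.

Lemma psd_sqrt n (X : 'M[C]_n) : psdmx X -> exists S : 'M[C]_n, X = S *m S^h.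
Proof.
move=> pX; have [P [d [PP PP' XE _]]] := herm_spectral (psd_herm pX).
have d_ge0 i : 0 <= d 0 i.
  have := psd_congr P^h pX; rewrite adjmxK (spectral_diagE PP XE).
  by move/(@psd_diag_ge0 _ _ i); rewrite mxE eqxx.
exists (P^h *m diag_mx (\row_i sqrtC (d 0 i))).
rewrite adjmxM adjmxK mulmxA -[_ *m diag_mx _ *m _]mulmxA.
suff -> : diag_mx (\row_i sqrtC (d 0 i)) *m (diag_mx (\row_i sqrtC (d 0 i)))^h = diag_mx d by [].
rewrite /adjmx map_diag_mx tr_diag_mx mulmx_diag; congr diag_mx; apply/rowP=> i.
by rewrite !mxE /= geC0_conj ?sqrtC_ge0 // -expr2 sqrtCK.
Qed.

Lemma psd_ker n (X : 'M[C]_n) (v : 'cV_n) :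
  psdmx X -> (v^h *m X *m v) 0 0 = 0 -> X *m v = 0.
Proof.
move=> /psd_sqrt[S ->] /eqP; rewrite mulmxA -mulmxA.
rewrite -{1}(adjmxK S) -adjmxM gram_eq0 => /eqP Sv.
by rewrite -mulmxA Sv mulmx0.
Qed.

(** If [x S S^h = 0] then [x S] has norm zero, so [S S^h] and [S] have the same left kernel. *)
Lemma rank_gram m n (S : 'M[C]_(m, n)) : \rank (S *m S^h) = \rank S.
Proof.
apply/eqP; rewrite eqn_leq mxrankM_maxl /=.
have : (kermx (S *m S^h) <= kermx S)%MS.
  apply/sub_kermxP/adjmx_inj; rewrite adjmx0; apply: gram_mx_eq0; rewrite adjmxK.
  by rewrite adjmxM !mulmxA -(mulmxA _ S) mulmx_ker mul0mx.
move/mxrankS; rewrite !mxrank_ker; have := rank_leq_row S.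
by have := rank_leq_row (S *m S^h); lia.
Qed.

(** The number of columns of [U] is the exact rank, on which the dimension count of [ppt_split]
    relies. A square root factors as [S = c r] through its column and row bases; the small Gram
    matrix [r r^h] is again some [T T^h], and [U = c T]. *)
Lemma psd_factor n (X : 'M[C]_n) : psdmx X ->
  exists U : 'M[C]_(n, \rank X), X = U *m U^h.
Proof.
move=> /psd_sqrt[S ->]; rewrite rank_gram.
have /psd_sqrt[T TE] := psd_gram (row_base S).
exists (col_base S *m T); rewrite adjmxM mulmxA -[_ *m T *m _]mulmxA -TE.
by rewrite mulmxA mulmx_base -[RHS]mulmxA -adjmxM mulmx_base.
Qed.

(* The form of the new matrix at w is the form of X at w - (v^h X w / v^h X v) v. *)
Lemma psd_schur n (X : 'M[C]_n) (v : 'cV_n) : psdmx X ->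
  psdmx (X - ((v^h *m X *m v) 0 0)^-1 *: (X *m v *m (X *m v)^h)).
Proof.
move=> pX; have hX := psd_herm pX; set d := (_ *m v) 0 0.
(* The inverse of 0 is 0 by convention, so nothing is subtracted when [d = 0]. *)
have [d0|d_neq0] := eqVneq d 0; first by rewrite d0 invr0 scale0r subr0.
have dE : v^h *m X *m v = d%:M by rewrite [LHS]mx11_scalar.
have dr : d^* = d.
  by have := adjmxE (v^h *m X *m v) 0 0; rewrite !adjmxM adjmxK hX mulmxA -/d.
pose T : 'M_n := 1%:M - d^-1 *: (v *m v^h *m X).
suff -> : X - d^-1 *: (X *m v *m (X *m v)^h) = T^h *m X *m T by exact: psd_congr.
rewrite /T adjmxB adjmx1 adjmxZ !adjmxM adjmxK hX fmorphV /= dr.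
rewrite mulmxBl mul1mx !mulmxBr !mulmx1 -!scalemxAl -!scalemxAr !mulmxA.
rewrite !mulmxBl -!scalemxAl.
have -> : X *m v *m v^h *m X *m v = d *: (X *m v).
  by rewrite -!mulmxA (mulmxA _ X) dE mul_mx_scalar -scalemxAr.
by rewrite -!scalemxAl scalerA mulVf // scale1r subrr scaler0 subr0.
Qed.

(** Since the trace is zero, the least eigenvalue [m] is negative; [t = - 1 / m] keeps every
    [1 + t d_i] nonnegative and makes the one at [m] vanish. *)
Lemma herm_boundary n (Z : 'M[C]_n) : Z^h = Z -> \tr Z = 0 -> Z != 0 ->
  exists t : C, [/\ 0 < t, psdmx (1%:M + t *: Z) & (\rank (1%:M + t *: Z)%R < n)%N].
Proof.
move=> hZ trZ Z0; have [P [d [PP PP' ZE d_real]]] := herm_spectral hZ.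
have trd : \sum_i d 0 i = 0.
  by rewrite -mxtrace_diag -trZ ZE -mulmxA [RHS]mxtrace_mulC -mulmxA PP mulmx1.
have [i0 di0] : exists i, d 0 i != 0.
  apply/existsP; apply: contraNT Z0 => /existsPn d0.
  rewrite ZE (_ : d = 0) ?linear0 ?mulmx0 ?mul0mx //.
  by apply/rowP=> i; rewrite mxE; apply/eqP; have := d0 i; rewrite negbK.
(* If the least eigenvalue were nonnegative, all would be, and their zero sum would force
   [d 0 i0 = 0]. *)
have [i [di_lt di_min]] : exists i, d 0 i < 0 /\ forall j, d 0 i <= d 0 j.
  case: (@real_arg_minP C _ i0 predT (fun i => d 0 i)) => // i _ dmin.
  exists i; split=> [|j]; last exact: dmin.
  rewrite real_ltNge //; apply: contraNN di0 => di_ge.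
  have d_ge j : 0 <= d 0 j by exact: le_trans di_ge (dmin _ _).
  by have /eqP := trd; rewrite psumr_eq0 // => /allP/(_ i0 (mem_index_enum _)).
pose t : C := (- d 0 i)^-1; exists t.
have t0 : 0 < t by rewrite invr_gt0 oppr_gt0.
have E : 1%:M + t *: Z = P^h *m diag_mx (\row_j (1 + t * d 0 j)) *m P.
  rewrite (_ : diag_mx _ = 1%:M + t *: diag_mx d); last first.
    by apply/matrixP=> a b; rewrite !mxE; case: eqP => _; rewrite ?mulr0n ?mulr0 ?addr0 ?mulr1n.
  by rewrite mulmxDr mulmxDl mulmx1 PP' -scalemxAr -scalemxAl -ZE.
split=> //.
  rewrite E; apply: psd_congr; split=> [|v].
    rewrite /adjmx map_diag_mx tr_diag_mx; congr diag_mx; apply/rowP=> j.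
    rewrite !mxE; apply/CrealP; rewrite rpredD ?rpred1 ?rpredM // ger0_real //; exact: ltW.
  rewrite -mulmxA mxE sumr_ge0 // => j _; rewrite mul_diag_mx !mxE mulrCA.
  rewrite mulr_ge0 //; last by rewrite mulrC -normCK exprn_ge0.
  rewrite addrC -lerBlDr sub0r mulrC ler_pdivlMr ?oppr_gt0 //.
  by rewrite mulrN mulN1r opprK.
(* Full rank would give a right inverse [W], but in the eigenbasis row [i] of [1 + t Z] is zero. *)
rewrite ltn_neqAle rank_leq_row andbT; apply/negP => /row_freeP[W].
rewrite E => /(congr1 (fun M => row i (P *m M *m P^h))).
rewrite !mulmxA PP mul1mx mulmx1 PP -!mulmxA !row_mul row_diag_mx mxE.
rewrite /t invrN mulNr mulVf ?ltr0_neq0 // subrr scale0r mul0mx.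
by move/matrixP/(_ 0 i)/eqP; rewrite !mxE eqxx eq_sym oner_eq0.
Qed.

End Positive.

(** * Partial transposition and the separable cone on C^2 (x) C^N *)

Section PartialTranspose.
Variable C : numClosedFieldType.

(** The transposition acts on the factor C^2: blocks change places but are not transposed
    themselves. *)
Definition pt m n (X : 'M[C]_(m + m, n + n)) : 'M[C]_(m + m, n + n) :=
  block_mx (ulsubmx X) (dlsubmx X) (ursubmx X) (drsubmx X).

Definition ppt N (X : 'M[C]_(N + N)) := psdmx X /\ psdmx (pt X).

(** This is [1 (x) T], a local operation on the second factor. *)
Definition loc m n (T : 'M[C]_(m, n)) : 'M[C]_(m + m, n + n) := block_mx T 0 0 T.

(** The column is the product vector [(a, b) (x) v], so this is the cone generated by projectors
    onto product vectors. *)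
Inductive sepcone N : 'M[C]_(N + N) -> Prop :=
| sepcone0 : sepcone 0
| sepconeS X (a b : C) (v : 'cV_N) : sepcone X ->
    sepcone (X + col_mx (a *: v) (b *: v) *m (col_mx (a *: v) (b *: v))^h).

Lemma pt_block m n (A B D E : 'M[C]_(m, n)) : pt (block_mx A B D E) = block_mx A D B E.
Proof. by rewrite /pt block_mxKul block_mxKdl block_mxKur block_mxKdr. Qed.

Lemma ptP m n a (X Y : 'M[C]_(m + m, n + n)) : pt (a *: X + Y) = a *: pt X + pt Y.
Proof.
rewrite -[X]submxK -[Y]submxK scale_block_mx add_block_mx !pt_block.
by rewrite scale_block_mx add_block_mx.
Qed.

Lemma ptD m n (X Y : 'M[C]_(m + m, n + n)) : pt (X + Y) = pt X + pt Y.
Proof. by have := ptP 1 X Y; rewrite !scale1r. Qed.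

Lemma pt0 m n : pt (0 : 'M[C]_(m + m, n + n)) = 0.
Proof. by rewrite -block_mx0 pt_block. Qed.

Lemma ptZ m n a (X : 'M[C]_(m + m, n + n)) : pt (a *: X) = a *: pt X.
Proof. by rewrite -[a *: X]addr0 ptP pt0 addr0. Qed.

Lemma pt_adj m n (X : 'M[C]_(m + m, n + n)) : pt X^h = (pt X)^h.
Proof. by rewrite -[X]submxK adjmx_block !pt_block adjmx_block. Qed.

Lemma loc_adj m n (T : 'M[C]_(m, n)) : (loc T)^h = loc T^h.
Proof. by rewrite /loc adjmx_block !adjmx0. Qed.

Lemma loc_block m n p q (S : 'M[C]_(m, n)) (T : 'M_(p, q)) A B D E :
  loc S *m block_mx A B D E *m loc T =
  block_mx (S *m A *m T) (S *m B *m T) (S *m D *m T) (S *m E *m T).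
Proof. by rewrite /loc !mulmx_block !(mul0mx, mulmx0, addr0, add0r). Qed.

Lemma pt_loc m n p q (S : 'M[C]_(m, n)) (T : 'M_(p, q)) X :
  pt (loc S *m X *m loc T) = loc S *m pt X *m loc T.
Proof. by rewrite -[X]submxK loc_block !pt_block loc_block. Qed.

Lemma ppt_loc M N (T : 'M[C]_(M, N)) X : ppt X -> ppt (loc T^h *m X *m loc T).
Proof.
by move=> [pX pG]; split; rewrite ?pt_loc -loc_adj; apply: psd_congr.
Qed.

Lemma sepconeD N (X Y : 'M[C]_(N + N)) : sepcone X -> sepcone Y -> sepcone (X + Y).
Proof.
move=> sX; elim=> [|Z a b v sZ IH]; first by rewrite addr0.
by rewrite addrA; apply: sepconeS.
Qed.

Lemma sepcone_loc M N (T : 'M[C]_(M, N)) X :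
  sepcone X -> sepcone (loc T *m X *m loc T^h).
Proof.
elim=> [|Z a b v sZ IH]; first by rewrite mulmx0 mul0mx; apply: sepcone0.
set w := col_mx _ _; rewrite mulmxDr mulmxDl.
have -> : loc T *m (w *m w^h) *m loc T^h = (loc T *m w) *m (loc T *m w)^h.
  by rewrite adjmxM loc_adj !mulmxA.
have -> : loc T *m col_mx (a *: v) (b *: v) = col_mx (a *: (T *m v)) (b *: (T *m v)).
  by rewrite /loc mul_block_col !mul0mx addr0 add0r -!scalemxAr.
by apply: sepconeS.
Qed.

Lemma sepconeZ N t (X : 'M[C]_(N + N)) : 0 <= t -> sepcone X -> sepcone (t *: X).
Proof.
move=> t0 /(sepcone_loc (sqrtC t)%:M); rewrite /loc.
suff -> : (sqrtC t)%:M^h = (sqrtC t)%:M :> 'M_N.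
  by rewrite -scalar_mx_block mul_scalar_mx mul_mx_scalar scalerA -expr2 sqrtCK.
by rewrite -scalemx1 adjmxZ adjmx1 geC0_conj ?sqrtC_ge0.
Qed.

Lemma sepcone_sum N k (a b : 'I_k -> C) (v : 'I_k -> 'cV_N) :
  sepcone (\sum_i col_mx (a i *: v i) (b i *: v i) *m (col_mx (a i *: v i) (b i *: v i))^h).
Proof.
elim/big_ind: _ => [||i _]; [exact: sepcone0|exact: sepconeD|].
by rewrite -[_ *m _]add0r; apply: sepconeS; apply: sepcone0.
Qed.

(** [Y Y^h] is the sum of the rank one matrices of the columns of [Y], and column [i] here is the
    product vector [(a_i, b_i) (x) w_i]. *)
Lemma sepcone_gram N k (W : 'M[C]_(N, k)) (a b : 'rV_k) :
  sepcone (col_mx (W *m diag_mx a) (W *m diag_mx b) *m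
           (col_mx (W *m diag_mx a) (W *m diag_mx b))^h).
Proof.
have := sepcone_sum (fun i => a 0 i) (fun i => b 0 i) (fun i => col i W).
congr sepcone; set Y := col_mx (_ *m _) _.
have YE i : col i Y = col_mx (a 0 i *: col i W) (b 0 i *: col i W).
  rewrite col_col_mx; congr col_mx;
  by apply/matrixP=> j o; rewrite ord1 mul_mx_diag !mxE mulrC.
apply/matrixP=> i j; rewrite summxE mxE; apply: eq_bigr => l _.
by rewrite -YE mxE big_ord1 !mxE.
Qed.

(* If M = sum_i l_i u_i u_i^h, then the decomposition uses the truncations of
   the u_i to the first N coordinates. *)
Lemma sepcone_normal N k (M : 'M[C]_(N + k)) : M *m M^h = M^h *m M ->
  sepcone (block_mx 1%:M (ulsubmx M) (ulsubmx M)^h (ulsubmx (M *m M^h))).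
Proof.
move=> nM; have [P [d [PP PP' ME]]] := normal_spectral nM.
pose W : 'M_(N, N + k) := usubmx P^h.
have WE (Z : 'M_(N + k)) : ulsubmx (P^h *m Z *m P) = W *m Z *m W^h.
  have -> : W^h = lsubmx P.
    by rewrite /W -[in LHS](hsubmxK P) adjmx_row col_mxKu adjmxK.
  by rewrite /ulsubmx -!mul_usub_mx -mulmx_lsub.
have hd : (diag_mx d)^h = diag_mx (\row_i (d 0 i)^* ).
  by rewrite /adjmx map_diag_mx tr_diag_mx; congr diag_mx; apply/rowP=> i; rewrite !mxE.
(* The second weight is the conjugate eigenvalue because the upper right block
   [W (W d^h)^h = W d W^h] has to be the compression of [M]. *)
have := sepcone_gram W (\row_i 1) (\row_i (d 0 i)^* ).
rewrite -hd (_ : diag_mx (\row_i 1) = 1%:M); last first.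
  by apply/matrixP=> i j; rewrite !mxE.
congr sepcone; rewrite mulmx1 adjmx_col mul_col_row adjmxM adjmxK !mulmxA.
congr block_mx.
- by have := WE 1%:M; rewrite !mulmx1 PP' scalar_mx_block block_mxKul.
- by rewrite -WE -ME.
- by rewrite ME WE !adjmxM adjmxK mulmxA.
rewrite nM (_ : M^h *m M = P^h *m ((diag_mx d)^h *m diag_mx d) *m P) ?WE ?mulmxA //.
by rewrite {1 2}ME !adjmxM adjmxK !mulmxA -(mulmxA _ P) PP mulmx1.
Qed.

End PartialTranspose.

(** * Splitting a PPT matrix into two of smaller rank sum *)

Section Split.
Variable C : numClosedFieldType.

Lemma psd_blocks m n (A : 'M[C]_m) B B' (D : 'M_n) :
  psdmx (block_mx A B B' D) -> psdmx A /\ psdmx D.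
Proof.
move=> pX; split.
  have := psd_congr (col_mx 1%:M 0) pX.
  by rewrite adjmx_col adjmx1 adjmx0 mul_row_block mul_row_col !(mul1mx, mul0mx, mulmx0, mulmx1, addr0).
have := psd_congr (col_mx 0 1%:M) pX.
by rewrite adjmx_col adjmx1 adjmx0 mul_row_block mul_row_col !(mul1mx, mul0mx, mulmx0, mulmx1, add0r).
Qed.

Lemma linear_ker (aT rT : vectType C) (f : aT -> rT) : linear f ->
  (dim rT < dim aT)%N -> exists2 v, v != 0 & f v = 0.
Proof.
move=> lf dlt; pose fL := GRing.isLinear.Build _ _ _ _ f lf.
pose g : {linear aT -> rT} := HB.pack f fL.
have := limg_ker_dim (linfun g) fullv; rewrite capfv dimvf => E.
have : lker (linfun g) != 0%VS.
  rewrite -dimv_eq0; apply: contraTneq dlt => k0; rewrite -leqNgt.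
  by rewrite -E k0 -(dimvf rT) dimvS ?subvf.
rewrite -vpick0 => v0; exists (vpick (lker (linfun g))) => //.
by have := memv_pick (lker (linfun g)); rewrite memv_ker lfunE => /eqP.
Qed.

(** There are [r r + s s] unknowns, against [(N + N) (N + N)] equations for the blocks and one for
    the trace. The trace equation prepares [herm_boundary] for the block diagonal matrix of [K] and
    [L]. *)
Lemma kernel_pair N r s (U : 'M[C]_(N + N, r)) (V : 'M_(N + N, s)) :
  ((N + N) * (N + N) + 1 < r * r + s * s)%N ->
  exists K L, [/\ (K, L) != 0, pt (U *m K *m U^h) = V *m L *m V^h & \tr K + \tr L = 0].
Proof.
move=> dlt.
pose f (KL : 'M[C]_r * 'M[C]_s) : 'M[C]_(N + N) * 'M[C]_1 :=
  (pt (U *m KL.1 *m U^h) - V *m KL.2 *m V^h, (\tr KL.1 + \tr KL.2)%:M).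
have lf : linear f.
  move=> a [K L] [K' L']; congr pair => /=.
    rewrite !(mulmxDr, mulmxDl) -!(scalemxAr, scalemxAl) ptP.
    by rewrite scalerBr opprD addrACA.
  by rewrite !mxtraceD !mxtraceZ; apply/matrixP=> i j; rewrite !mxE !ord1 !mulr1n; ring.
have dlt' : ((N + N) * (N + N) + 1 * 1 < r * r + s * s)%N by rewrite muln1.
have [[K L] KL0 []] := linear_ker lf dlt'.
move=> /subr0_eq KL /matrixP/(_ 0 0); rewrite !mxE mulr1n => tKL.
by exists K, L.
Qed.

(** The solution space is stable under adjoints, so the Hermitian and the skew part of a solution
    are solutions, and one of them is nonzero. *)
Lemma herm_kernel_pair N r s (U : 'M[C]_(N + N, r)) (V : 'M_(N + N, s)) :
  ((N + N) * (N + N) + 1 < r * r + s * s)%N ->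
  exists K L, [/\ (K, L) != 0, K^h = K, L^h = L,
     pt (U *m K *m U^h) = V *m L *m V^h & \tr K + \tr L = 0].
Proof.
move=> /(kernel_pair U V)[K [L [KL0 KLE KLT]]].
have combo (a : C) : let K' := a *: K + a^* *: K^h in let L' := a *: L + a^* *: L^h in
  [/\ K'^h = K', L'^h = L', pt (U *m K' *m U^h) = V *m L' *m V^h & \tr K' + \tr L' = 0].
  split.
  - by rewrite adjmxD !adjmxZ conjCK adjmxK addrC.
  - by rewrite adjmxD !adjmxZ conjCK adjmxK addrC.
  - rewrite !(mulmxDr, mulmxDl) -!(scalemxAr, scalemxAl) ptP ptZ KLE.
    have -> : U *m K^h *m U^h = (U *m K *m U^h)^h by rewrite !adjmxM adjmxK mulmxA.
    by rewrite pt_adj KLE !adjmxM adjmxK mulmxA.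
  - rewrite !mxtraceD !mxtraceZ !mxtrace_adj addrACA -!mulrDr -rmorphD /= KLT.
    by rewrite rmorph0 !mulr0 addr0.
have [h1|h1] := eqVneq (K + K^h, L + L^h) 0; last first.
  by exists (K + K^h), (L + L^h); have := combo 1; rewrite /= conjC1 !scale1r => -[].
(* Here [K] and [L] are skew-Hermitian, so the new pair is [2 i (K, L)]. *)
exists ('i *: K + 'i^* *: K^h), ('i *: L + 'i^* *: L^h).
have [? ? ? ?] := combo 'i; split=> //; apply: contra KL0.
case: h1 => /addr0_eq <- /addr0_eq <-.
rewrite conjCi !scaleNr !scalerN !opprK -!scalerDr -!mulr2n.
rewrite -[X in X == _]/('i *: ((K, L) *+ 2)) scaler_eq0 (negPf (neq0Ci _)) /=.
by rewrite -scaler_nat scaler_eq0 pnatr_eq0.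
Qed.

(** The moved matrix is [U (1 + t K) U^h] and its partial transpose is [V (1 + t L) V^h]. Applied to
    the diagonal sum of [K] and [L], [herm_boundary] keeps both middle factors positive and makes
    their total rank less than [r + s]. *)
Lemma ppt_shift N (X : 'M[C]_(N + N)) r s (U : 'M_(N + N, r)) (V : 'M_(N + N, s)) K L :
  X = U *m U^h -> pt X = V *m V^h -> (K, L) != 0 -> K^h = K -> L^h = L ->
  pt (U *m K *m U^h) = V *m L *m V^h -> \tr K + \tr L = 0 ->
  exists t : C, [/\ 0 < t, ppt (X + t *: (U *m K *m U^h)) &
    (\rank (X + t *: (U *m K *m U^h))%R + \rank (pt (X + t *: (U *m K *m U^h))) < r + s)%N].
Proof.
move=> XE GE KL0 hK hL KLE KLT.
have [||| t [t0 pZ rZ]] := @herm_boundary _ _ (block_mx K 0 0 L).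
- by rewrite adjmx_block !adjmx0 hK hL.
- by rewrite mxtrace_block.
- apply: contra KL0 => /eqP; rewrite -[0 in RHS]block_mx0 => /eq_block_mx[-> _ _ ->].
  by [].
have ZE : 1%:M + t *: block_mx K 0 0 L = block_mx (1%:M + t *: K) 0 0 (1%:M + t *: L).
  by rewrite scalar_mx_block scale_block_mx add_block_mx !scaler0 !addr0.
move: pZ rZ; rewrite ZE rank_diag_block_mx => /psd_blocks[pK pL] rKL.
have X1 : X + t *: (U *m K *m U^h) = U *m (1%:M + t *: K) *m U^h.
  by rewrite XE mulmxDr mulmxDl mulmx1 -scalemxAr -scalemxAl.
have G1 : pt (X + t *: (U *m K *m U^h)) = V *m (1%:M + t *: L) *m V^h.
  by rewrite ptD ptZ KLE GE mulmxDr mulmxDl mulmx1 -scalemxAr -scalemxAl.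
exists t; split=> //.
  split; first by rewrite X1 -{1}[U]adjmxK; apply: psd_congr.
  by rewrite G1 -{1}[V]adjmxK; apply: psd_congr.
apply: leq_ltn_trans rKL; rewrite G1 X1.
by apply: leq_add; apply: leq_trans (mxrankM_maxl _ _) (mxrankM_maxr _ _).
Qed.

Lemma ppt_split N (X : 'M[C]_(N + N)) (rX := \rank X) (rG := \rank (pt X)) :
  ppt X -> ((N + N) * (N + N) + 1 < rX * rX + rG * rG)%N ->
  exists X1 X2 a b, [/\ 0 <= a, 0 <= b, X = a *: X1 + b *: X2,
   ppt X1 /\ (\rank X1 + \rank (pt X1) < rX + rG)%N &
   ppt X2 /\ (\rank X2 + \rank (pt X2) < rX + rG)%N].
Proof.
move=> [pX pG]; have [U XE] := psd_factor pX; have [V GE] := psd_factor pG.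
move=> /(herm_kernel_pair U V)[K [L [KL0 hK hL KLE KLT]]].
have [t [t0 p1 r1]] := ppt_shift XE GE KL0 hK hL KLE KLT.
have [|||||u [u0 p2 r2]] := @ppt_shift _ _ _ _ U V (- K) (- L) XE GE.
- by rewrite -[_ == _]/((- (K, L)) == 0) oppr_eq0.
- by rewrite adjmxN hK.
- by rewrite adjmxN hL.
- by rewrite !(mulmxN, mulNmx) -KLE -scaleN1r ptZ scaleN1r.
- by rewrite !linearN /= -opprD KLT oppr0.
(* The two ends lie at distances [t] and [u] on opposite sides of [X]; these weights cancel the
   displacements. *)
exists (X + t *: (U *m K *m U^h)), (X + u *: (U *m - K *m U^h)), (u / (t + u)), (t / (t + u)).
have tu : t + u != 0 by rewrite lt0r_neq0 ?addr_gt0.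
split=> //; rewrite ?divr_ge0 ?addr_ge0 ?ltW //.
rewrite mulmxN mulNmx scalerN !scalerDr scalerN !scalerA.
rewrite addrACA -scalerDl -mulrDl [u + t]addrC divff // scale1r.
by rewrite mulrAC [t / _ * u]mulrAC [t * u]mulrC subrr addr0.
Qed.

End Split.

(** * Schur complements of rank at most one and normal extensions *)

Section RankOne.
Variable C : numClosedFieldType.

Local Notation "A ^c" := (map_mx Num.conj A) (format "A ^c").

(* A linear relation V x = W y has a mirror image V (y^c) = W (x^c), and the sum
   of the two (or i times their difference) is self-conjugate. *)
Lemma conj_relation n k (V W : 'M[C]_(n, k)) : (n < k + k)%N ->
  V^h *m V = (W^h *m W)^T -> V^h *m W = (V^h *m W)^T ->
  exists2 z : 'cV_k, z != 0 & V *m z = W *m z^c.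
Proof.
move=> nk VV VW.
(* By the Gram hypotheses, [V y^c - W x^c] has the same norm as [V x - W y]. *)
have mirror (x y : 'cV_k) : V *m x = W *m y -> V *m y^c = W *m x^c.
  move=> xy; apply/eqP; rewrite -subr_eq0; apply/eqP/gram_mx_eq0.
  have : ((V *m x - W *m y)^h *m (V *m x - W *m y))^T = 0.
    by rewrite xy subrr mulmx0 trmx0.
  move=> <-; rewrite !adjmxB !adjmxM.
  have cT (z : 'cV_k) : (z^c)^h = z^T by apply/matrixP=> i j; rewrite !mxE conjCK.
  have hT (z : 'cV_k) : z^h^T = z^c by rewrite /adjmx trmxK.
  have assoc m (z : 'M_(m, k)) (A B : 'M[C]_(n, k)) (u : 'cV_k) :
      z *m A^h *m (B *m u) = z *m (A^h *m B) *m u by rewrite !mulmxA.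
  have tB (A B : 'M[C]_1) : (A - B)^T = A^T - B^T by rewrite linearB.
  rewrite !cT !mulmxBl !mulmxBr !assoc !tB.
  have trE (z u : 'cV_k) (A : 'M[C]_k) : (z^h *m A *m u)^T = u^T *m A^T *m z^c.
    by rewrite !trmx_mul hT mulmxA.
  have WV : (W^h *m V)^T = W^h *m V.
    have -> : W^h *m V = (V^h *m W)^h by rewrite adjmxM adjmxK.
    by move: (V^h *m W) VW => Q QQ; rewrite {2}QQ /adjmx !map_trmx !trmxK.
  have VVT : (V^h *m V)^T = W^h *m W by rewrite VV trmxK.
  by rewrite !trE VVT -VV -VW WV !opprB addrACA [RHS]addrACA; congr (_ + _); rewrite addrC.
(* The [k + k] columns of [V] and [W] lie in dimension [n < k + k], hence are dependent. *)
have [u u0 uE] : exists2 u : 'cV_(k + k), u != 0 & row_mx V W *m u = 0.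
  have dlt : (n * 1 < (k + k) * 1)%N by rewrite !muln1.
  have lf : linear (mulmx (row_mx V W) : 'cV_(k + k) -> 'cV_n).
    by move=> a x y; rewrite linearP.
  by have [u] := linear_ker lf dlt; exists u.
pose x := usubmx u; pose y := - dsubmx u.
have xy : V *m x = W *m y.
  by apply/eqP; rewrite mulmxN -addr_eq0 -mul_row_col vsubmxK uE.
have yx := mirror _ _ xy.
have cK (z : 'cV_k) : z^c^c = z by apply/matrixP=> i j; rewrite !mxE conjCK.
have [s0|s0] := eqVneq (x + y^c) 0; last first.
  by exists (x + y^c) => //; rewrite mulmxDr xy yx -mulmxDr map_mxD cK addrC.
exists ('i *: (x - y^c)).
  rewrite scaler_eq0 (negPf (neq0Ci _)) /=; apply: contra u0 => /eqP d0.
  have x0 : x = 0.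
    have /eqP : x *+ 2 = (x + y^c) + (x - y^c) by rewrite addrACA subrr addr0.
    by rewrite s0 d0 addr0 -scaler_nat scaler_eq0 pnatr_eq0 => /eqP.
  have y0 : y = 0.
    by move/eqP: d0; rewrite x0 sub0r oppr_eq0 map_mx_eq0 => /eqP.
  by rewrite -[u]vsubmxK -/x x0 -[dsubmx u]opprK -/y y0 oppr0 col_mx0.
rewrite map_mxZ /= conjCi map_mxB cK -!scalemxAr mulmxBr xy yx scaleNr -scalerN.
by rewrite -mulmxBr -mulmxN opprB.
Qed.

Lemma mx11_tr (A B : 'M[C]_1) : \tr A = \tr B -> A = B.
Proof. by rewrite !trace_mx11 => AB; rewrite [A]mx11_scalar AB -mx11_scalar. Qed.

Lemma tr_rank1 n (p : 'cV[C]_n) (A : 'M_n) : \tr (p^h *m A *m p) = \tr (p *m p^h *m A).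
Proof. by rewrite mxtrace_mulC !mulmxA. Qed.

(** Take traces: those of [B^h B] and [B B^h] agree. *)
Lemma defect_norm n (B D : 'M[C]_n) (p q : 'cV_n) :
  D = B^h *m B + p *m p^h -> D = B *m B^h + q *m q^h -> p^h *m p = q^h *m q.
Proof.
move=> DP DQ; apply: mx11_tr; rewrite mxtrace_mulC [RHS]mxtrace_mulC.
apply: (addrI (\tr (B^h *m B))); rewrite -mxtraceD -DP.
by rewrite [\tr (B^h *m B)]mxtrace_mulC -mxtraceD -DQ.
Qed.

(* The block matrix M = (B, q; p^h, c) is normal and M M^h has D as its upper
   left block. *)
Lemma sepcone_extension N (B D : 'M[C]_N) (p q : 'cV_N) (c : C) :
  D = B^h *m B + p *m p^h -> D = B *m B^h + q *m q^h ->
  B *m p + c^* *: q = B^h *m q + c *: p ->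
  sepcone (block_mx 1%:M B B^h D).
Proof.
move=> DP DQ pq.
have pp := defect_norm DP DQ.
pose M : 'M_(N + 1) := block_mx B q p^h c%:M.
have Mh : M^h = block_mx B^h p q^h (c^* )%:M.
  rewrite /M adjmx_block adjmxK; congr block_mx.
  by rewrite -scalemx1 adjmxZ adjmx1 scalemx1.
have MM : M *m M^h = block_mx D (B *m p + c^* *: q) (B *m p + c^* *: q)^h
                       (p^h *m p + (c * c^* )%:M).
  rewrite Mh mulmx_block -DQ mul_mx_scalar mul_scalar_mx mul_scalar_mx.
  by rewrite scale_scalar_mx adjmxD adjmxM adjmxZ conjCK.
have := @sepcone_normal C N 1 M; rewrite MM /M !block_mxKul; apply.
rewrite -/M Mh mulmx_block -DP !mul_mx_scalar !mul_scalar_mx scale_scalar_mx.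
by rewrite pq pp adjmxD adjmxM adjmxK adjmxZ mulrC.
Qed.

Lemma sepcone_rank1 N (B D : 'M[C]_N) (p q : 'cV_N) : (N <= 3)%N ->
  D = B^h *m B + p *m p^h -> D = B *m B^h + q *m q^h ->
  sepcone (block_mx 1%:M B B^h D).
Proof.
move=> N3 DP DQ.
have D2 Z : \tr (B^h *m B *m Z) + \tr (p *m p^h *m Z) =
            \tr (B *m B^h *m Z) + \tr (q *m q^h *m Z).
  by rewrite -!mxtraceD -!mulmxDl -DP -DQ.
have E0 := esym (defect_norm DP DQ).
have E1 : q^h *m B *m q = p^h *m B *m p.
  (* Both expressions for [D] are traced against [B]; the cubic terms agree by cyclicity. *)
  apply: mx11_tr; rewrite !tr_rank1; have := D2 B.
  by rewrite -[B *m B^h *m B]mulmxA [\tr (B *m (B^h *m B))]mxtrace_mulC => /addrI.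
have E2 : q^h *m B^h *m q = p^h *m B^h *m p.
  by apply: adjmx_inj; rewrite !adjmxM !adjmxK !mulmxA.
(* Expanding the trace of [D^2] both ways, the pure squares agree and twice the cross terms
   remain. *)
have E3 : q^h *m (B *m B^h) *m q = p^h *m (B^h *m B) *m p.
  apply: mx11_tr; rewrite !tr_rank1.
  pose P := p *m p^h; pose Q := q *m q^h; pose F := B^h *m B; pose G := B *m B^h.
  rewrite -/P -/Q -/F -/G.
  have FG : \tr (F *m F) = \tr (G *m G).
    by rewrite /F /G -mulmxA mxtrace_mulC !mulmxA.
  have PQ : \tr (P *m P) = \tr (Q *m Q).
    by rewrite /P /Q -!tr_rank1 !mulmxA -E0 -!mulmxA -E0.
  have FPGQ : F + P = G + Q by rewrite -DP -DQ.
  have : \tr ((F + P) *m (F + P)) = \tr ((G + Q) *m (G + Q)) by rewrite FPGQ.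
  rewrite !(mulmxDl, mulmxDr) !mxtraceD FG PQ.
  rewrite (mxtrace_mulC F P) (mxtrace_mulC G Q) !addrA => /addIr.
  rewrite -!addrA => /addrI; rewrite -!mulr2n => /eqP.
  by rewrite eqrMn2r /= => /eqP.
pose V := row_mx q (B^h *m q); pose W := row_mx p (B *m p).
have T1 (A : 'M[C]_1) : A^T = A by apply/matrixP=> i j; rewrite mxE !ord1.
have [|||z z0 zE] := @conj_relation N (1 + 1) V W.
(* Four columns in dimension [N <= 3]. *)
- by lia.
- rewrite /V /W !adjmx_row !mul_col_row tr_block_mx !T1 !adjmxM !adjmxK !mulmxA.
  by move: E0 E1 E2 E3; rewrite !mulmxA => -> -> -> ->.
(* Both off-diagonal entries of [V^h W] are [q^h B p]. *)
- rewrite /V /W !adjmx_row !mul_col_row tr_block_mx !T1 !adjmxM !adjmxK !mulmxA.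
  by [].
pose z1 := usubmx z 0 0; pose z2 := dsubmx z 0 0.
have zr : z1 *: q + z2 *: (B^h *m q) = z1^* *: p + z2^* *: (B *m p).
  rewrite -[z]vsubmxK map_col_mx !mul_row_col in zE; move: zE.
  rewrite [usubmx z]mx11_scalar [dsubmx z]mx11_scalar !map_scalar_mx.
  by rewrite !mul_mx_scalar.
(* If [z2 = 0], then [p] and [q] differ by a phase and [B] is normal; the block matrix is that of
   [B] with [B^h B] in the corner, plus the projector of [(0, 1) (x) p]. *)
have [z20|z20] := eqVneq z2 0.
  have z10 : z1 != 0.
    apply: contra z0 => /eqP z10; rewrite -[z]vsubmxK [usubmx z]mx11_scalar.
    by rewrite [dsubmx z]mx11_scalar -/z1 -/z2 z10 z20 raddf0 col_mx0.
  move: zr; rewrite z20 conjC0 !scale0r !addr0 => zr.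
  have qp : q *m q^h = p *m p^h.
    have /(congr1 (fun v => v *m v^h)) := zr.
    rewrite !adjmxZ -!scalemxAl -!scalemxAr !scalerA conjCK [z1^* * _]mulrC.
    by apply: scalerI; rewrite mulf_neq0 ?conjC_eq0.
  have BB : B *m B^h = B^h *m B by apply: (addIr (q *m q^h)); rewrite -DQ DP qp.
  have sN : sepcone (block_mx 1%:M B B^h (B^h *m B)).
    apply: (@sepcone_extension _ _ _ 0 0 0); rewrite ?mul0mx ?addr0 ?BB //.
    by rewrite !mulmx0 conjC0.
  have := sepconeS 0 1 p sN; rewrite adjmx_col mul_col_row scale0r scale1r.
  by rewrite adjmx0 !(mul0mx, mulmx0) add_block_mx !addr0 -DP.
(* In the polar form [z2 = r u], multiplying the relation by [u / r] isolates [B p] and gives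
   [B^h q] the coefficient [u^2]. So [q] is replaced by [u^2 q], and [c] is read off from the
   coefficient of [p]. *)
have [r [u [r0 rr z2E uu]]] : exists r u, [/\ r != 0, r^* = r, z2 = r * u & u * u^* = 1].
  exists `|z2|, (z2 / `|z2|); have r0 : `|z2| != 0 by rewrite normr_eq0.
  have rr : `|z2|^* = `|z2| by rewrite geC0_conj ?normr_ge0.
  split=> //; first by rewrite mulrC divfK.
  by rewrite rmorphM fmorphV /= rr mulrACA -normCK -invfM -expr2 divff ?expf_neq0.
have {}zr : B *m p = (u / r) *: (z1 *: q + z2 *: (B^h *m q) - z1^* *: p).
  rewrite zr [_ *: p + _]addrC addrK scalerA z2E rmorphM /= rr.
  by rewrite (_ : u / r * (r * u^* ) = 1) ?scale1r // mulrA divfK // uu.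
pose c := - (u / r * z1^* ).
have cE : c^* * u ^+ 2 = - (u / r * z1).
  rewrite /c rmorphN !rmorphM fmorphV /= conjCK rr.
  by rewrite -[u in RHS]mulr1 -uu; field.
apply: (@sepcone_extension _ _ _ p (u ^+ 2 *: q) c) => //.
  rewrite adjmxZ -scalemxAl -scalemxAr scalerA rmorphXn /= -exprMn uu.
  by rewrite expr1n scale1r.
rewrite zr scalerBr scalerDr !scalerA cE (_ : u / r * z2 = u ^+ 2); last first.
  by rewrite z2E; field.
by rewrite -scalemxAr /c !scaleNr addrAC [X in X - _]addrC addKr.
Qed.

End RankOne.

(** * Positive partial transpose implies separability for [N <= 3] *)

Section LowDimension.
Variable C : numClosedFieldType.

Lemma psd1 n : psdmx (1%:M : 'M[C]_n).
Proof. by have := psd_gram (1%:M : 'M[C]_n); rewrite adjmx1 mulmx1. Qed.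

Lemma psd_tr0 n (X : 'M[C]_n) : psdmx X -> \tr X = 0 -> X = 0.
Proof.
move=> /psd_sqrt[S ->] trS; suff -> : S = 0 by rewrite mul0mx.
rewrite -[S]adjmxK -(adjmx0 C n n); congr adjmx; apply/matrixP=> i j.
rewrite [RHS]mxE; apply/eqP; rewrite adjmxE conjC_eq0 -normr_eq0 -sqrf_eq0.
have SE l : (S *m S^h) l l = \sum_m `|S l m| ^+ 2.
  by rewrite mxE; apply: eq_bigr => m _; rewrite adjmxE normCK.
have S_ge l : 0 <= (S *m S^h) l l.
  by rewrite SE sumr_ge0 // => m _; rewrite exprn_ge0.
have /eqP := trS; rewrite /mxtrace psumr_eq0 // => /allP/(_ j (mem_index_enum _)).
rewrite /= SE psumr_eq0 => [/allP/(_ i (mem_index_enum _))//|m _].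
by rewrite exprn_ge0.
Qed.

Lemma psd_rank1 n (X : 'M[C]_n) : psdmx X -> (\rank X <= 1)%N ->
  exists p : 'cV_n, X = p *m p^h.
Proof.
move=> /psd_factor[U XE]; case: (\rank X) U XE => [|[|//]] U XE _; last by exists U.
by exists 0; rewrite XE (thinmx0 U) !mul0mx.
Qed.

(** Congruence by a unipotent matrix turns the block matrix into the diagonal sum of [1] and
    [D - B^h B]. *)
Lemma psd_schur1 N (B D : 'M[C]_N) : psdmx (block_mx 1%:M B B^h D) ->
  psdmx (D - B^h *m B) /\
  (N + \rank (D - B^h *m B)%R <= \rank (block_mx 1%:M B B^h D))%N.
Proof.
move=> pX; pose L := block_mx 1%:M (- B) 0 1%:M : 'M[C]_(N + N).
have LE : L^h *m block_mx 1%:M B B^h D *m L = block_mx 1%:M 0 0 (D - B^h *m B).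
  rewrite /L adjmx_block adjmxN adjmx0 !adjmx1 !mulmx_block.
  by rewrite !(mul1mx, mulmx1, mul0mx, mulmx0, addr0, add0r, mulNmx, addNr) [- _ + _]addrC.
split; first by have := psd_congr L pX; rewrite LE => /psd_blocks[].
rewrite -{1}(mxrank1 C N) -rank_diag_block_mx -LE.
exact: leq_trans (mxrankM_maxl _ _) (mxrankM_maxr _ _).
Qed.

Lemma herm_blocks N (X : 'M[C]_(N + N)) : X^h = X ->
  X = block_mx (ulsubmx X) (ursubmx X) (ursubmx X)^h (drsubmx X).
Proof.
move=> hX; rewrite -[LHS]submxK; congr block_mx.
by rewrite -{1}hX -{1}[X]submxK adjmx_block block_mxKdl.
Qed.

(** All blocks live on the orthogonal complement of [f]. Its projector [P] has rank below [N] and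
    factors as [U U^h], so [loc U] carries the problem to the smaller size [\rank P] and back. *)
Lemma sepcone_compress N (A B D : 'M[C]_N) (f : 'cV_N) : f != 0 ->
  (forall M, (M < N)%N -> forall Y : 'M[C]_(M + M), ppt Y -> sepcone Y) ->
  ppt (block_mx A B B^h D) ->
  A *m f = 0 -> B *m f = 0 -> B^h *m f = 0 -> D *m f = 0 ->
  sepcone (block_mx A B B^h D).
Proof.
move=> f0 IH pX Af Bf Bhf Df; set X := block_mx A B B^h D.
have [/psd_herm hX _] := pX.
pose d := (f^h *m f) 0 0; pose P : 'M[C]_N := 1%:M - d^-1 *: (f *m f^h).
have d0 : d != 0 by rewrite gram_eq0.
have pP : psdmx P by have := psd_schur f (psd1 N); rewrite mul1mx mulmx1 -/d.
have Pf : P *m f = 0.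
  rewrite mulmxBl mul1mx -scalemxAl -mulmxA [f^h *m f]mx11_scalar -/d mul_mx_scalar.
  by rewrite scalerA mulVf // scale1r subrr.
have rP : (\rank P < N)%N.
  rewrite ltn_neqAle rank_leq_row andbT; apply: contra f0 => /eqP rP.
  have uP : P \in unitmx by rewrite -row_free_unit /row_free rP.
  by rewrite -[f](mulKmx uP) Pf mulmx0.
have [U PE] := psd_factor pP.
have rightP Z : Z *m f = 0 -> Z *m P = Z.
  by move=> Zf; rewrite mulmxBr mulmx1 -scalemxAr mulmxA Zf mul0mx scaler0 subr0.
have leftP Z : Z^h *m f = 0 -> P *m Z = Z.
  by move/rightP/(congr1 (@adjmx C _ _)); rewrite adjmxM adjmxK (psd_herm pP).
have XE : X = loc U *m (loc U^h *m X *m loc U) *m loc U^h.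
  have UU : loc U *m loc U^h = loc P.
    by rewrite /loc mulmx_block !(mul0mx, mulmx0, addr0, add0r) -PE.
  rewrite !mulmxA UU -(mulmxA _ (loc U)) UU loc_block.
  move: hX; rewrite /X adjmx_block => /eq_block_mx[{}hA _ _ {}hD].
  by rewrite !leftP ?rightP // ?adjmxK ?hA ?hD.
by rewrite XE; apply: sepcone_loc; apply: IH => //; apply: ppt_loc.
Qed.

(** Positivity of the matrix and of its partial transpose, tested on [(f, 0)], gives [B^h f = 0] and
    [B f = 0]. A Schur complement along [(0, f)] then preserves both positivities, subtracts a
    multiple of a product projector and leaves a corner [D'] that kills [f]. *)
Lemma sepcone_singular N (A B D : 'M[C]_N) (f : 'cV_N) : f != 0 -> A *m f = 0 ->
  (forall M, (M < N)%N -> forall Y : 'M[C]_(M + M), ppt Y -> sepcone Y) ->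
  ppt (block_mx A B B^h D) -> sepcone (block_mx A B B^h D).
Proof.
move=> f0 Af IH [pX]; rewrite pt_block => pG.
have [pA pD] := psd_blocks pX.
have kerB B' : psdmx (block_mx A B'^h B' D) -> B' *m f = 0.
  move=> /(@psd_ker _ _ _ (col_mx f 0)).
  rewrite adjmx_col adjmx0 -mulmxA mul_block_col mul_row_col Af.
  rewrite !(mulmx0, mul0mx, addr0) mxE => /(_ erefl).
  by rewrite -col_mx0 => /eq_col_mx[].
have Bf : B *m f = 0 by exact: kerB.
have Bhf : B^h *m f = 0 by apply: kerB; rewrite adjmxK.
pose d := (f^h *m D *m f) 0 0; pose D' := D - d^-1 *: (D *m f *m (D *m f)^h).
have schur B' : B' *m f = 0 -> psdmx (block_mx A B' B'^h D) ->
    psdmx (block_mx A B' B'^h D').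
  move=> B'f /(psd_schur (col_mx 0 f)).
  rewrite adjmx_col adjmx0 -mulmxA mul_block_col mul_row_col B'f.
  rewrite !(mulmx0, mul0mx, addr0, add0r) mulmxA -/d adjmx_col adjmx0.
  rewrite mul_col_row !(mulmx0, mul0mx) scale_block_mx !scaler0.
  by rewrite opp_block_mx add_block_mx !oppr0 !addr0.
have d_ge0 : 0 <= d by case: pD => _; apply.
have D'f : D' *m f = 0.
  (* When [d = 0], [D'] is [D], and [D f = 0] by positivity. *)
  have [d0|d0] := eqVneq d 0.
    by rewrite /D' d0 invr0 scale0r subr0; apply: psd_ker.
  rewrite mulmxBl -scalemxAl adjmxM (psd_herm pD) -(mulmxA (D *m f)) [_ *m D *m f]mx11_scalar -/d.
  by rewrite mul_mx_scalar scalerA mulVf // scale1r subrr.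
have sX : sepcone (block_mx A B B^h D').
  apply: (sepcone_compress f0) => //; split; first exact: schur.
  by rewrite pt_block -{2}[B]adjmxK; apply: schur; rewrite ?adjmxK.
(* The subtracted term is put back. *)
have := sepconeS 0 (sqrtC d^-1) (D *m f) sX.
rewrite adjmx_col !adjmxZ mul_col_row !scale0r !conjC0 !scale0r !(mul0mx, mulmx0).
rewrite add_block_mx !addr0 -scalemxAl -scalemxAr scalerA.
by rewrite geC0_conj ?sqrtC_ge0 ?invr_ge0 // -expr2 sqrtCK subrK.
Qed.

Lemma sepcone_unital N (B D : 'M[C]_N) (X := block_mx 1%:M B B^h D) : (N <= 3)%N ->
  (forall Y : 'M[C]_(N + N), ppt Y ->
     (\rank Y + \rank (pt Y) < \rank X + \rank (pt X))%N -> sepcone Y) ->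
  ppt X -> sepcone X.
Proof.
move=> N3 IH pX; have [pX1 pG1] := pX.
move: pG1; rewrite /X pt_block => pG1.
have [pP rP] := psd_schur1 pX1.
have [pQ rQ] : psdmx (D - B *m B^h) /\
  (N + \rank (D - B *m B^h)%R <= \rank (block_mx 1%:M B^h B D))%N.
  by have := @psd_schur1 N B^h D; rewrite adjmxK; apply.
have PQ : \tr (D - B^h *m B) = \tr (D - B *m B^h).
  by rewrite !linearB /= mxtrace_mulC.
(* Positive matrices of equal trace vanish together. Hence, if one defect has rank at least 2, the
   other has rank at least 1. *)
have P0 : D - B^h *m B = 0 <-> D - B *m B^h = 0.
  by split=> Z0; apply: psd_tr0 => //; [rewrite -PQ|rewrite PQ]; rewrite Z0 linear0.
have [/andP[rP1 rQ1]|big] := boolP ((\rank (D - B^h *m B)%R <= 1) && (\rank (D - B *m B^h)%R <= 1))%N.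
  have [p pE] := psd_rank1 pP rP1; have [q qE] := psd_rank1 pQ rQ1.
  by apply: (@sepcone_rank1 _ _ _ _ p q) => //; rewrite -?pE -?qE addrC subrK.
have rPQ : (\rank (D - B^h *m B)%R == 0%N) = (\rank (D - B *m B^h)%R == 0%N).
  by rewrite !mxrank_eq0; apply/eqP/eqP => /P0.
(* One rank is at least [N + 2], the other at least [N + 1], and [(N + 2)^2 + (N + 1)^2 > 4 N^2 + 1]
   holds exactly for [N <= 3]. *)
have big' : ((N + N) * (N + N) + 1 < \rank X * \rank X + \rank (pt X) * \rank (pt X))%N.
  rewrite [pt X]pt_block.
  move: (\rank (block_mx 1%:M B^h B D)) (\rank X) rQ rP rPQ big.
  move: (\rank _) (\rank _) => y x s r ys xr xy big.
  have [h|h] : ((N + 2 <= r) && (N + 1 <= s) \/ (N + 1 <= r) && (N + 2 <= s))%N by lia.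
    have /andP[h1 h2] := h; have := leq_mul h1 h1; have := leq_mul h2 h2.
    by case: N N3 {IH X pX pX1 pG1 pP pQ PQ P0 B D ys xr h h1 h2} => [|[|[|[|//]]]] _; lia.
  have /andP[h1 h2] := h; have := leq_mul h1 h1; have := leq_mul h2 h2.
  by case: N N3 {IH X pX pX1 pG1 pP pQ PQ P0 B D ys xr h h1 h2} => [|[|[|[|//]]]] _; lia.
have [X1 [X2 [a [b [a0 b0 XE [p1 r1] [p2 r2]]]]]] := ppt_split pX big'.
by rewrite -/X XE; apply: sepconeD; apply: sepconeZ => //; apply: IH.
Qed.

Lemma ppt_sepcone N (X : 'M[C]_(N + N)) : (N <= 3)%N -> ppt X -> sepcone X.
Proof.
have [n] := ubnP N; elim: n => // n IHn in N X *; rewrite ltnS => Nn N3.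
have IH M : (M < N)%N -> forall Y : 'M[C]_(M + M), ppt Y -> sepcone Y.
  by move=> MN Y; apply: IHn; [exact: leq_trans MN Nn|exact: leq_trans (ltnW MN) N3].
have [k] := ubnP (\rank X + \rank (pt X))%N; elim: k => // k IHk in X *.
rewrite ltnS => Xk pX; have [pX1 _] := pX.
have XE := herm_blocks (psd_herm pX1).
have [uA|] := boolP (ulsubmx X \in unitmx); last first.
  rewrite -row_free_unit -kermx_eq0 => /rowV0Pn[v /sub_kermxP vA v0].
  have hA : (ulsubmx X)^h = ulsubmx X.
    by move: (psd_herm pX1); rewrite {1 2}XE adjmx_block => /eq_block_mx[].
  rewrite XE; apply: (@sepcone_singular _ _ _ _ v^h); rewrite -?XE //.
    by apply: contra v0 => /eqP/(congr1 (@adjmx C _ _)); rewrite adjmxK adjmx0 => /eqP.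
  by apply: adjmx_inj; rewrite adjmxM adjmxK hA vA adjmx0.
have [S AE] : exists S : 'M_N, ulsubmx X = S *m S^h.
  by apply: psd_sqrt; rewrite XE in pX1; have [] := psd_blocks pX1.
have uS : S \in unitmx by move: uA; rewrite AE unitmx_mul => /andP[].
(* This invertible local congruence turns the corner [S S^h] into [1] without raising either
   rank. *)
pose T := (invmx S)^h; pose Y := loc T^h *m X *m loc T.
have pY : ppt Y by exact: ppt_loc.
have XY : X = loc S *m Y *m loc S^h.
  have locM (U V : 'M[C]_N) : loc U *m loc V = loc (U *m V).
    by rewrite /loc mulmx_block !(mul0mx, mulmx0, addr0, add0r).
  have loc1 : loc 1%:M = 1%:M :> 'M[C]_(N + N) by rewrite /loc -scalar_mx_block.
  rewrite /Y !mulmxA locM adjmxK mulmxV // loc1 mul1mx -mulmxA locM -adjmxM.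
  by rewrite mulmxV // adjmx1 loc1 mulmx1.
rewrite XY; apply: sepcone_loc.
have YE : Y = block_mx 1%:M (ursubmx Y) (ursubmx Y)^h (drsubmx Y).
  rewrite {1}(herm_blocks (psd_herm (proj1 pY))); congr block_mx.
  rewrite /Y XE loc_block block_mxKul AE adjmxK -mulmxA mulmxA mulKmx //.
  by rewrite -adjmxM mulVmx // adjmx1.
have rY : (\rank Y + \rank (pt Y) <= \rank X + \rank (pt X))%N.
  rewrite /Y pt_loc; apply: leq_add;
  exact: leq_trans (mxrankM_maxl _ _) (mxrankM_maxr _ _).
rewrite YE; apply: sepcone_unital => //; rewrite -?YE // => Z pZ rZ.
by apply: IHk => //; apply: leq_trans rZ (leq_trans rY Xk).
Qed.

End LowDimension.

(** * From maps and Schmidt number to 2x2 block matrices *)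

Section Amplification.
Variable C : numClosedFieldType.

Lemma tidxK m n (i : 'I_m) (j : 'I_n) : tidx (mxvec_index i j) = (i, j).
Proof. by rewrite /tidx /mxvec_index cast_ordK enum_rankK. Qed.

Lemma ampl_comp n d (phi psi : 'M[C]_d -> 'M[C]_d) X :
  ampl n (phi \o psi) X = ampl n phi (ampl n psi X).
Proof.
apply/matrixP=> p q; rewrite !mxE /=; congr (phi _ _ _).
by apply/matrixP=> a b; rewrite !mxE !tidxK.
Qed.

Lemma ampl_sum n d (phi : {linear 'M[C]_d -> 'M[C]_d}) k (p : 'I_k -> C) Y :
  ampl n phi (\sum_j p j *: Y j) = \sum_j p j *: ampl n phi (Y j).
Proof.
apply/matrixP=> x y; rewrite mxE summxE.
rewrite (eq_bigr (fun j => (p j *: phi (\matrix_(a, b)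
  Y j (mxvec_index (tidx x).1 a) (mxvec_index (tidx y).1 b))) (tidx x).2 (tidx y).2)).
  rewrite -summxE -(eq_bigr _ (fun j _ => linearZZ phi (p j) _)) -linear_sum.
  congr (phi _ _ _); apply/matrixP=> a b; rewrite mxE !summxE.
  by apply: eq_bigr => j _; rewrite !mxE.
by move=> j _; rewrite !mxE.
Qed.

Lemma psd_tr n (A : 'M[C]_n) : psdmx A -> psdmx A^T.
Proof.
move=> /psd_sqrt[S ->]; rewrite trmx_mul.
have -> : S^T = S^h^T^h by rewrite /adjmx; apply/matrixP=> i j; rewrite !mxE conjCK.
exact: psd_gram.
Qed.

Lemma psd_mxsub m n (f : 'I_m -> 'I_n) (A : 'M[C]_n) : psdmx A -> psdmx (mxsub f f A).
Proof.
move=> /psd_sqrt[S ->]; have -> : mxsub f f (S *m S^h) = rowsub f S *m (rowsub f S)^h.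
  by apply/matrixP=> i j; rewrite !mxE; apply: eq_bigr => l _; rewrite !mxE.
exact: psd_gram.
Qed.

(** Complete positivity is applied to the projector of [e_0 (x) v + e_1 (x) w]; [f] reindexes
    [2 * d] as [d + d]. *)
Lemma cp_block d (phi : 'M[C]_d -> 'M[C]_d) (v w : 'cV_d) : completely_positive phi ->
  psdmx (block_mx (phi (v *m v^h)) (phi (v *m w^h)) (phi (w *m v^h)) (phi (w *m w^h))).
Proof.
pose u (i : 'I_2) : 'cV_d := if i == 0 then v else w.
pose b : 'cV[C]_(2 * d) := \col_p u (tidx p).1 (tidx p).2 0.
pose f (j : 'I_(d + d)) := match split j with
  inl x => mxvec_index (0 : 'I_2) x | inr x => mxvec_index (1 : 'I_2) x end.
move=> /(_ 2 _ (psd_gram b))/(psd_mxsub f); congr psdmx.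
have E i j : (\matrix_(x, y) (b *m b^h) (mxvec_index i x) (mxvec_index j y)) =
    u i *m (u j)^h.
  by apply/matrixP=> x y; rewrite !mxE !big_ord1 !mxE !tidxK.
have fl i : f (lshift d i) = mxvec_index 0 i by rewrite /f (unsplitK (inl i)).
have fr i : f (rshift d i) = mxvec_index 1 i by rewrite /f (unsplitK (inr i)).
rewrite -[LHS]submxK; congr block_mx; apply/matrixP=> i j; rewrite !mxE;
by rewrite !(fl, fr) !tidxK E.
Qed.

(** The decomposition clause of [separable], isolated so that it can be summed and scaled. *)
Definition sepsum m n (s : 'M[C]_(m * n)) :=
  exists (N : nat) (p : 'I_N -> C) (al : 'I_N -> 'M[C]_m) (be : 'I_N -> 'M[C]_n),
    (forall j, 0 <= p j /\ psdmx (al j) /\ psdmx (be j)) /\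
    s = \sum_(j < N) p j *: kron (al j) (be j).

Lemma sepsum0 m n : sepsum (0 : 'M[C]_(m * n)).
Proof.
exists 0%N, (fun _ => 0), (fun _ => 0), (fun _ => 0).
by split=> [[]//|]; rewrite big_ord0.
Qed.

Lemma sepsumD m n (s t : 'M[C]_(m * n)) : sepsum s -> sepsum t -> sepsum (s + t).
Proof.
move=> [N [p [al [be [pos ->]]]]] [N' [p' [al' [be' [pos' ->]]]]].
pose glue T (g : 'I_N -> T) g' (j : 'I_(N + N')) :=
  match split j with inl i => g i | inr i => g' i end.
exists (N + N')%N, (glue _ p p'), (glue _ al al'), (glue _ be be'); split.
  by move=> j; rewrite /glue; case: (split j).
rewrite big_split_ord; congr (_ + _); apply: eq_bigr => i _; rewrite /glue.
  by rewrite (unsplitK (inl i)).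
by rewrite (unsplitK (inr i)).
Qed.

Lemma sepsum_kron m n (A : 'M[C]_m) (B : 'M[C]_n) : psdmx A -> psdmx B -> sepsum (kron A B).
Proof.
move=> pA pB; exists 1%N, (fun _ => 1), (fun _ => A), (fun _ => B).
by split=> [_|]; [split; [exact: ler01|]|rewrite big_ord1 scale1r].
Qed.

Lemma sepsumZ m n a (s : 'M[C]_(m * n)) : 0 <= a -> sepsum s -> sepsum (a *: s).
Proof.
move=> a0 [N [p [al [be [pos ->]]]]]; exists N, (fun j => a * p j), al, be.
split=> [j|]; first by have [? ?] := pos j; split; rewrite ?mulr_ge0.
by rewrite scaler_sumr; apply: eq_bigr => j _; rewrite scalerA.
Qed.

(* sum_(k, l) u_k u_l^h (x) X_kl for a 2x2 block matrix X. *)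
Definition attach m n (u v : 'cV[C]_m) (X : 'M[C]_(n + n)) : 'M[C]_(m * n) :=
  kron (u *m u^h) (ulsubmx X) + kron (u *m v^h) (ursubmx X) +
  (kron (v *m u^h) (dlsubmx X) + kron (v *m v^h) (drsubmx X)).

Lemma attach0 m n (u v : 'cV[C]_m) : attach u v (0 : 'M[C]_(n + n)) = 0.
Proof. by apply/matrixP=> p q; rewrite /attach !mxE !mulr0 !addr0. Qed.

Lemma attachD m n (u v : 'cV[C]_m) (X Y : 'M[C]_(n + n)) :
  attach u v (X + Y) = attach u v X + attach u v Y.
Proof. by apply/matrixP=> p q; rewrite /attach !mxE; ring. Qed.

(** Attaching sends [(a, b) (x) w] to the product vector [(a u + b v) (x) w]. *)
Lemma attach_rank1 m n (u v : 'cV[C]_m) a b (w : 'cV[C]_n) (x := col_mx (a *: w) (b *: w)) :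
  attach u v (x *m x^h) = kron ((a *: u + b *: v) *m (a *: u + b *: v)^h) (w *m w^h).
Proof.
rewrite /attach /x adjmx_col mul_col_row block_mxKul block_mxKur block_mxKdl block_mxKdr.
apply/matrixP=> p q; rewrite !mxE !big_ord1 !mxE !rmorphD !rmorphM /=; ring.
Qed.

Lemma sepsum_attach m n (u v : 'cV[C]_m) (X : 'M[C]_(n + n)) :
  sepcone X -> sepsum (attach u v X).
Proof.
elim=> [|Y a b w _ IH]; first by rewrite attach0; apply: sepsum0.
rewrite attachD; apply: sepsumD => //.
by rewrite attach_rank1; apply: sepsum_kron; apply: psd_gram.
Qed.

(** The rank factorization is padded with zeros by [pid_mx], so the inner dimension is [k] even when
    the rank is smaller. *)
Lemma rank_factor m n k (A : 'M[C]_(m, n)) : (\rank A <= k)%N ->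
  exists (L : 'M_(m, k)) (R : 'M_(k, n)), A = L *m R.
Proof.
move=> rk; exists (col_base A *m pid_mx (\rank A)), (pid_mx (\rank A) *m row_base A).
rewrite -mulmxA (mulmxA (pid_mx _)) pid_mx_id // pid_mx_1 mul1mx.
by rewrite mulmx_base.
Qed.

(** Factoring the coefficient matrix of [a] as [L R] gives [a = u (x) w + v (x) x], with [u], [v]
    the columns of [L] and [w], [x] the rows of [R]. *)
Lemma ampl_schmidt2 n d (phi : {linear 'M[C]_d -> 'M[C]_d}) (a : 'cV_(n * d)) :
  (schmidt_rank a <= 2)%N -> exists (u v : 'cV_n) (w x : 'cV_d),
    ampl n phi (a *m a^h) = attach u v
      (block_mx (phi (w *m w^h)) (phi (w *m x^h)) (phi (x *m w^h)) (phi (x *m x^h))).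
Proof.
move=> /rank_factor[L [R aE]].
exists (col 0 L), (col 1 L), (row 0 R)^T, (row 1 R)^T.
set w := (row 0 R)^T; set x := (row 1 R)^T.
rewrite /attach block_mxKul block_mxKur block_mxKdl block_mxKdr.
apply/matrixP=> p q; rewrite [LHS]mxE.
set i := (tidx p).1; set j := (tidx q).1.
have row_a k : (\col_y a (mxvec_index k y) 0) = L k 0 *: w + L k 1 *: x.
  apply/matrixP=> y o; move/matrixP/(_ k y): aE; rewrite !mxE => ->.
  by rewrite !big_ord_recl big_ord0 addr0 (_ : lift ord0 ord0 = 1) //; apply: val_inj.
have -> : (\matrix_(y, z) (a *m a^h) (mxvec_index i y) (mxvec_index j z)) =
    (L i 0 *: w + L i 1 *: x) *m (L j 0 *: w + L j 1 *: x)^h.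
  by rewrite -!row_a; apply/matrixP=> y z; rewrite !mxE !big_ord1 !mxE.
rewrite adjmxD !adjmxZ !(mulmxDl, mulmxDr) -!(scalemxAl, scalemxAr) !scalerA.
rewrite !(linearD, linearZZ) /= !mxE !big_ord1 !mxE; ring.
Qed.

(** For the transposed map, [cp_block] yields a matrix of transposed blocks; its full transpose
    restores the blocks and exchanges the off-diagonal ones. *)
Lemma ppt_map_block d (phi : 'M[C]_d -> 'M[C]_d) (w x : 'cV_d) : PPT_map phi ->
  ppt (block_mx (phi (w *m w^h)) (phi (w *m x^h)) (phi (x *m w^h)) (phi (x *m x^h))).
Proof.
move=> [cp ccp]; split; first exact: cp_block.
by have := psd_tr (cp_block w x ccp); rewrite tr_block_mx !trmxK pt_block.
Qed.

Lemma schmidt2_separable n d (phi : {linear 'M[C]_d -> 'M[C]_d}) (s : 'M_(n * d)) :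
  (d <= 3)%N -> PPT_map phi -> schmidt_number_le 2 s -> separable (ampl n phi s).
Proof.
move=> d3 pphi [ps [N [p [a [p0 [ra ->]]]]]]; split.
  apply: (proj1 pphi); elim/big_ind: _ => [||j _].
  - exact: psd0.
  - exact: psdD.
  - by apply: psdZ => //; apply: psd_gram.
rewrite ampl_sum -/(sepsum _); elim/big_ind: _ => [||j _].
- exact: sepsum0.
- exact: sepsumD.
apply: sepsumZ => //; have [u [v [w [x ->]]]] := ampl_schmidt2 phi (ra j).
by apply: sepsum_attach; apply: ppt_sepcone => //; apply: ppt_map_block.
Qed.

End Amplification.

Theorem theorem3 (R : realType) (n : nat)
  (phi1 phi2 : {linear 'M[R[i]]_3 -> 'M[R[i]]_3}) (rho : 'M[R[i]]_(n * 3)) :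
  PPT_map phi1 -> completely_positive phi2 -> is_state rho ->
  schmidt_number_le 2 (ampl n phi2 rho) ->
  separable (ampl n (phi1 \o phi2) rho).
Proof.
by move=> pphi1 _ _ s2; rewrite ampl_comp; apply: schmidt2_separable.
Qed.
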